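(* For any randomized policy for the multi-agent ski-rental problem and any of the three types of competitive ratio (overall $\mathrm{CR}^{(\mathrm{OV})}$, state-dependent $\mathrm{CR}^{(\mathrm{SD})}$, and individual rational $\mathrm{CR}^{(\mathrm{IND})}_m$), the competitive ratio is lower-bounded by $\frac{e}{e-1}$ when the individual-buy cost $B$ (hence the group-buy cost $G$ as well) is sufficiently large.
   Context: Multi-agent ski-rental problem: $M,B,G$ are known positive integers with $B<G<MB$. There are agents $m\in\{1,\dots,M\}$. An instance is $\mathcal I=\{N_1,\dots,N_M\}$ with positive integers $N_1\le\dots\le N_M$, where $N_m$ is the number of active days of agent $m$; these are unknown in advance to an online policy, and $N_m$ is revealed at the end of day $N_m$, when agent $m$ becomes inactive. On each day $t\le N_m$, agent $m$, if it has not yet bought a pass, takes one of the actions: Rent (cost $1$), Ind (buy an individual pass, cost $B$, covering all its remaining active days), or Group (join the purchase of a group pass, cost $G/k$, where $k$ is the number of agents taking the action Group on that day, covering all its remaining active days). An agent that is inactive or has already bought a pass takes the action Null (cost $0$). A deterministic policy $\pi$ maps the history of the decision process to one action for each agent. $\mathrm{Cost}_m(\pi,\mathcal I)$ is the total cost of agent $m$ over days $1,\dots,N_m$, and $\mathrm{Cost}(\pi,\mathcal I)=\sum_{m=1}^M\mathrm{Cost}_m(\pi,\mathcal I)$. A randomized policy $f$ is a probability distribution over deterministic policies (possibly realized by sampling at specific points of the process), and its costs are the expectations over $\pi\sim f$ of $\mathrm{Cost}(\pi,\mathcal I)$ and $\mathrm{Cost}_m(\pi,\mathcal I)$, denoted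 $\mathrm{Cost}(f,\mathcal I)$ and $\mathrm{Cost}_m(f,\mathcal I)$. State: when $\ell$ agents have become inactive (because their active days have passed, without buying), the state is the list $\{N_n\}_{n\le\ell}$ of their revealed numbers of active days (abbreviated $\ell$; empty list if $\ell=0$), $0\le\ell\le M-1$. $\mathfrak I\mid\{N_n\}_{n\le\ell}$ denotes the set of instances whose first $\ell$ agents have active days $\{N_n\}_{n\le\ell}$. Benchmarks: $\mathrm{OPT}^{(\mathrm{OV})}(\mathcal I)=\min\{G,\sum_{m=1}^M\min\{B,N_m\}\}$; $\mathrm{OPT}^{(\mathrm{SD})}(\mathcal I\mid\{N_n\}_{n\le\ell})=\sum_{n=1}^{\ell}N_n+\min\{G,\sum_{n=\ell+1}^M\min\{N_n,B\}\}$; and, with $\ell_*=\min\{0\le j\le M-1: N_{j+1}>\min\{G/(M-j),B\}\}$ ($\ell_*=M$ if there is no such $j$, with $G/0=+\infty$), $\mathrm{OPT}^{(\mathrm{IND})}_m(\mathcal I)=N_m$ if $N_m\le\min\{G/(M-\ell_* ),B\}$ and $\min\{G/(M-\ell_* ),B\}$ otherwise. Competitive ratios (maxima over $\mathcal I\in\mathfrak I\mid\{N_n\}_{n\le\ell}$): $\mathrm{CR}^{(\mathrm{OV})}(f\mid\{N_n\}_{n\le\ell})=\max\mathrm{Cost}(f,\mathcal I)/\mathrm{OPT}^{(\mathrm{OV})}(\mathcal I)$; $\mathrm{CR}^{(\mathrm{SD})}(f\mid\{N_n\}_{n\le\ell})=\max\mathrm{Cost}(f,\mathcal I)/\mathrm{OPT}^{(\mathrm{SD})}(\mathcal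 I\mid\{N_n\}_{n\le\ell})$; $\mathrm{CR}^{(\mathrm{IND})}_m(f\mid\{N_n\}_{n\le\ell})=\max\mathrm{Cost}_m(f,\mathcal I)/\mathrm{OPT}^{(\mathrm{IND})}_m(\mathcal I)$.
   Formalization: The bound is proved asymptotically: for each ε>0, M and state, every ratio is at least e/(e−1)−ε for all large B (the exact bound fails, e.g. M=4, G=4B−1); the individual ratio is bounded only for agents still active in the state, as it can be 1 for agents whose N_m is revealed. *)

(* Defs.v *)
From HB Require Import structures.
From mathcomp Require Import all_boot all_order all_algebra.
From mathcomp Require Import all_classical all_reals all_analysis.
Set Implicit Arguments.
Unset Strict Implicit.
Unset Printing Implicit Defensive.
Import Order.TTheory GRing.Theory Num.Theory.
Local Open Scope ring_scope.

Inductive decision := Rent | Ind | Group.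

Definition decision_code (a : decision) : option bool :=
  match a with Rent => None | Ind => Some false | Group => Some true end.
Definition decision_decode (x : option bool) : decision :=
  match x with None => Rent | Some false => Ind | Some true => Group end.
Lemma decision_codeK : cancel decision_code decision_decode.
Proof. by case. Qed.
HB.instance Definition _ := Finite.copy decision (can_type decision_codeK).
HB.instance Definition _ := isPointed.Build decision Rent.

(* Agents are 0-based: the ordinal m : 'I_M is the (m+1)-st agent.
   The value None of [option decision] is the action Null. *)
Definition joint_action (M : nat) := {ffun 'I_M -> option decision}.

(* What is observed on one day: the actions taken, and the agents that become
   inactive at the end of the day. *)
Definition day_record (M : nat) := (joint_action M * {set 'I_M})%type.

(* The records of the completed days, in chronological order. *)
Definition history (M : nat) := seq (day_record M).

(* The decision [pi h m] is only carried out when agent m is still active and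
   has no pass after the history h; otherwise agent m takes Null, see
   [play]. *)
Definition policy (M : nat) := history M -> 'I_M -> decision.

(* An instance N gives the numbers of active days. *)
Definition instance (M : nat) := 'I_M -> nat.

Section Process.
Variables (M : nat) (pi : policy M) (N : instance M).

Definition has_pass (h : history M) (m : 'I_M) : bool :=
  has (fun r : day_record M =>
         (r.1 m == Some Ind) || (r.1 m == Some Group)) h.

Definition play (h : history M) : joint_action M :=
  [ffun m => if (size h < N m)%N && ~~ has_pass h m
             then Some (pi h m) else None].

(* The history after t days; day t.+1 is the one played at [hist t]. *)
Fixpoint hist (t : nat) : history M :=
  if t is t'.+1 then
    rcons (hist t') (play (hist t'), [set m | N m == t'.+1]%SET)
  else [::].

End Process.

Section Costs.
Variables (R : realType) (M B G : nat).

Definition action_cost (a : joint_action M) (m : 'I_M) : R :=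
  match a m with
  | None => 0
  | Some Rent => 1
  | Some Ind => B%:R
  | Some Group => G%:R / #|[pred n | a n == Some Group]|%:R
  end.

Definition agent_cost (m : 'I_M) (N : instance M) (pi : policy M) : R :=
  \sum_(t < N m) action_cost (play pi N (hist pi N t)) m.

Definition total_cost (N : instance M) (pi : policy M) : R :=
  \sum_(m < M) agent_cost m N pi.

End Costs.

Local Open Scope classical_set_scope.

(* The product sigma-algebra on policies, generated by the events
   "the decision for agent m after history h is a". *)
Definition policy_cylinders (M : nat) : set (set (policy M)) :=
  [set C | exists h m a, C = [set pi | pi h m = a]].

Definition randomized_policy (R : realType) (M : nat) :=
  probability (g_sigma_algebraType (@policy_cylinders M)) R.

(* A state is the list s of the numbers of active days of the first [size s]
   agents. *)
Definition is_state (M : nat) (s : seq nat) : bool :=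
  [&& (size s < M)%N, all (fun n => 0 < n)%N s & sorted leq s].

Definition instances (M : nat) (s : seq nat) : set (instance M) :=
  [set N : instance M | (forall m : 'I_M, 0 < N m)%N /\
           {homo N : i j / (i <= j)%N} /\
           (forall m : 'I_M, (m < size s)%N -> N m = nth 0%N s m)].

Section Benchmarks.
Variables (R : realType) (M B G : nat) (N : instance M).

Definition OPT_OV : R :=
  Num.min G%:R (\sum_(m < M) Num.min B%:R (N m)%:R).

Definition OPT_SD (s : seq nat) : R :=
  \sum_(m < M | (m < size s)%N) (N m)%:R +
  Num.min G%:R (\sum_(m < M | (size s <= m)%N) Num.min (N m)%:R B%:R).

(* min {G / (M - j), B}, with the convention G / 0 = +oo when j = M. *)
Definition threshold (j : nat) : R :=
  if (j < M)%N then Num.min (G%:R / (M - j)%:R) B%:R else B%:R.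

Definition lstar : nat :=
  \big[minn/M]_(j < M | threshold j < (N j)%:R) (j : nat).

Definition OPT_IND (m : 'I_M) : R :=
  if (N m)%:R <= threshold lstar then (N m)%:R else threshold lstar.

End Benchmarks.

Section CompetitiveRatios.
Variables (R : realType) (M B G : nat) (f : randomized_policy R M).
Local Open Scope ereal_scope.

Definition Cost (N : instance M) : \bar R := 'E_f[total_cost R B G N].

Definition Cost_agent (m : 'I_M) (N : instance M) : \bar R :=
  'E_f[agent_cost R B G m N].

Definition CR_OV (s : seq nat) : \bar R :=
  ereal_sup [set Cost N / (OPT_OV R B G N)%:E | N in @instances M s].

Definition CR_SD (s : seq nat) : \bar R :=
  ereal_sup [set Cost N / (OPT_SD R B G N s)%:E | N in @instances M s].

Definition CR_IND (m : 'I_M) (s : seq nat) : \bar R :=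
  ereal_sup [set Cost_agent m N / (OPT_IND R B G N m)%:E
            | N in @instances M s].

End CompetitiveRatios.

(* Main.v *)
Require Import Defs.
From mathcomp Require Import all_boot all_order all_algebra.
From mathcomp Require Import all_classical all_reals all_analysis.
From mathcomp Require Import ring lra.
Import Order.TTheory GRing.Theory Num.Theory.
Set Implicit Arguments.
Unset Strict Implicit.
Unset Printing Implicit Defensive.
Local Open Scope ring_scope.

(** The adversary only uses instances in which, after the observed state [s] of
    length [l], all [M - l] late agents leave on the same day [n].  There the
    best late price per agent is [p = min {B, G / (M - l)}], and every benchmark
    is at most [min {p, n}] per late agent, up to a constant.  A policy cannot
    tell these instances apart before their last day, so if [x t] is the
    probability that a late agent has no pass after [t] days (averaged over the
    late agents for the total cost), the expected cost per late agent at horizon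
    [n] is at least [F n = \sum_(t < n) x t.+1 + p * (1 - x n)].  For a single
    agent this fails by a constant only: the group price may be shared with early
    agents on the first few days, when it is still at least [B / M], but buying
    on those days with probability more than O(1/B) is not competitive at a
    bounded horizon.  Finally [F n <= c * min {p, n} + C] for all [n] is a linear
    recurrence for the partial sums of [x] which forces [c >= e / (e - 1)] up to
    an error O(1 / p). *)

(** * The discrete recurrence that forces [e / (e - 1)] *)

Lemma ski_rental_survival_bound (R : realType) (c C p : R) (n0 : nat)
    (x : nat -> R) :
  1 < p -> 1 <= c -> 0 <= C -> n0%:R <= p ->
  (forall n, 0 <= x n) -> (forall n, x n.+1 <= x n) ->
  (forall n, (n0 <= n)%N ->
    \sum_(i < n) x i.+1 + p * (1 - x n) <= c * Num.min p n%:R + C) ->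
  (p - 1) * (expR 1 - (expR 1 - 1) * c) <=
  c + expR 1 * (c - 1 + c * n0%:R + C).
Proof.
move=> p1 c1 C0 n0p x0 xS ub.
pose S n := \sum_(i < n) x i.+1.
have SS n : S n.+1 = S n + x n.+1 by rewrite /S big_ord_recr.
have S0 n : 0 <= S n by apply: sumr_ge0.
(* [n |-> c * n + p * (c - 1) + C] solves the recurrence given by equality in
   the bound on [S n + p * (1 - x n)]; [D] is the deviation from it. *)
pose D n := S n - c * n%:R - (p * (c - 1) + C).
have xle m n : (m <= n)%N -> x n <= x m.
  move=> mn; rewrite -(subnKC mn); elim: (n - m)%N => [|k IH]; first by rewrite addn0.
  by rewrite addnS (le_trans (xS _)).
have ubl n : (n0 <= n)%N -> S n + p * (1 - x n) <= c * n%:R + C.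
  move=> /ub /le_trans; apply; rewrite lerD2r ler_wpM2l ?ge_min ?lexx ?orbT//; lra.
have ubp n : (n0 <= n)%N -> S n + p * (1 - x n) <= c * p + C.
  move=> /ub /le_trans; apply; rewrite lerD2r ler_wpM2l ?ge_min ?lexx//; lra.
pose q := Num.trunc p.
have /andP[qp pq] : q%:R <= p < q.+1%:R by apply: truncn_itv; lra.
have n0q : (n0 <= q)%N by rewrite -ltnS -(ltr_nat R); lra.
pose r := (p - 1)^-1.
have r0 : 0 < r by rewrite invr_gt0; lra.
have rE : (p - 1) * r = 1 by rewrite mulfV//; lra.
(* In the bound at [n.+1] the term [x n.+1] has coefficient [1 - p]; solving for it gives
   [x n.+1 >= c + r * D n]. *)
have DS n : (n0 <= n)%N -> (1 + r) * D n <= D n.+1.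
  move=> nn; have := ubl n.+1 (leqW nn); rewrite SS => H.
  rewrite -(@ler_pM2l _ (p - 1)); last lra.
  have -> : (p - 1) * ((1 + r) * D n) = (p - 1 + (p - 1) * r) * D n by ring.
  rewrite rE subrK /D SS -natr1; rewrite -natr1 in H.
  lra.
pose E := c * n0%:R + p * (c - 1) + C.
have n00 : (0 : R) <= n0%:R by [].
have E0 : 0 <= E by rewrite /E; nra.
have Dlow k : - ((1 + r) ^+ k * E) <= D (n0 + k)%N.
  elim: k => [|k IH].
    rewrite addn0 expr0 /D /E; have := S0 n0; lra.
  rewrite addnS (le_trans _ (DS _ _)) ?leq_addr// exprS -mulrA -mulrN.
  by rewrite ler_wpM2l//; lra.
(* At horizon [q + q.+1] the final probability [x] is charged rent on [q.+1 > p] further days, which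
   outweighs the saving [p * x]. The plateau bound thus yields [S q + p <= c * p + C]. *)
have Dq : D q <= - (c * (p - 1)).
  have H : S q + p <= c * p + C.
    apply: le_trans (ubp (q + q.+1)%N _); last by rewrite (leq_trans n0q)// leq_addr.
    rewrite mulrBr mulr1.
    have : S q + q.+1%:R * x (q + q.+1)%N <= S (q + q.+1)%N.
      rewrite /S big_split_ord/= lerD2l mulr_natl -[X in _ *+ X]card_ord -sumr_const.
      by apply: ler_sum => i _; apply: xle; rewrite -addnS leq_add2l.
    have := x0 (q + q.+1)%N; nra.
  rewrite -natr1 in pq; rewrite /D; nra.
(* The exponent is at most [p], and [r * p = 1 + r]; this is where [e] enters. *)
have pw : (1 + r) ^+ (q - n0) <= expR 1 * expR r.
  rewrite -expRD; have -> : 1 + r = p * r by move: rE; lra.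
  apply: (@le_trans _ _ (expR (r * (q - n0)%:R))).
    rewrite expRM_natr lerXn2r ?nnegrE ?expR_ge0//; first by nra.
    by apply: le_trans (expR_ge1Dx r); lra.
  rewrite ler_expR natrB//; nra.
have K : c * (p - 1) <= expR 1 * expR r * E.
  have := Dlow (q - n0)%N; rewrite subnKC// => H.
  have : (1 + r) ^+ (q - n0) * E <= expR 1 * expR r * E by rewrite ler_wpM2r.
  lra.
(* [expR (- r) >= 1 - r] trades the factor [expR r] for an additive loss [c], as
   [(p - 1) * r = 1]. *)
have K2 : c * (p - 1) * (1 - r) <= expR 1 * E.
  have e1 : expR r * expR (- r) = 1 by rewrite expRxMexpNx_1.
  have := expR_ge1Dx (- r) => H1.
  apply: (@le_trans _ _ (c * (p - 1) * expR (- r))).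
    by rewrite ler_wpM2l ?mulr_ge0//; lra.
  have := expR_gt0 (- r); have := expR_gt0 r.
  have : c * (p - 1) * expR (- r) <= expR 1 * expR r * E * expR (- r).
    by rewrite ler_wpM2r ?expR_ge0.
  move: e1; set u := expR r; set v := expR (- r); set e := expR 1 => e1.
  have -> : e * u * E * v = (u * v) * (e * E) by ring.
  by rewrite e1 mul1r.
have : c * (p - 1) * (1 - r) = c * (p - 1) - c.
  by rewrite mulrBr mulr1 -[_ * r]mulrA rE mulr1.
move: K2; rewrite /E; set e := expR 1; lra.
Qed.

(** * Indistinguishability of the horizons *)

Definition flat_instance (M : nat) (s : seq nat) (n : nat) : instance M :=
  fun m => if (m < size s)%N then nth 0%N s m else n.

Section Process.
Variables (M : nat) (pi : policy M).

Lemma size_hist (N : instance M) t : size (hist pi N t) = t.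
Proof. by elim: t => //= t IH; rewrite size_rcons IH. Qed.

Definition unbought (N : instance M) (t : nat) (m : 'I_M) : bool :=
  ~~ has_pass (hist pi N t) m.

Lemma playE (N : instance M) t m :
  play pi N (hist pi N t) m =
  if (t < N m)%N && unbought N t m then Some (pi (hist pi N t) m) else None.
Proof. by rewrite ffunE size_hist. Qed.

Lemma unboughtS (N : instance M) t m :
  unbought N t.+1 m =
  unbought N t m && (play pi N (hist pi N t) m \notin [:: Some Ind; Some Defs.Group]).
Proof. by rewrite /unbought /has_pass /= has_rcons /= negb_or andbC !inE. Qed.

Lemma nth_hist (N : instance M) r0 t n : (t < n)%N ->
  (nth r0 (hist pi N n) t).1 = play pi N (hist pi N t).
Proof.
elim: n => // n IH; rewrite ltnS leq_eqVlt /= nth_rcons size_hist => /predU1P[->|tn].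
  by rewrite ltnn eqxx.
by rewrite tn IH.
Qed.

Section Flat.
Variable s : seq nat.
Local Notation flat := (flat_instance s).

Lemma play_flat n n' t : hist pi (flat n) t = hist pi (flat n') t ->
  (t < n)%N -> (t < n')%N ->
  play pi (flat n) (hist pi (flat n) t) = play pi (flat n') (hist pi (flat n') t).
Proof.
move=> E tn tn'; apply/ffunP => m; rewrite !ffunE E !size_hist /flat_instance.
by case: (m < size s)%N; rewrite ?tn ?tn'.
Qed.

(** Through day [t] no late agent has left under either horizon, so actions and recorded departures
    coincide. Strictness matters: the record of day [n] shows the departures at horizon [n]. *)
Lemma hist_flat n n' t : (t < n)%N -> (t < n')%N ->
  hist pi (flat n) t = hist pi (flat n') t.
Proof.
elim: t => // t IH tn tn' /=; have [H H'] := (ltnW tn, ltnW tn').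
rewrite (play_flat (IH H H') H H') IH//; congr rcons; congr pair.
apply/setP => m; rewrite !inE /flat_instance; case: (m < size s)%N => //.
by rewrite !gtn_eqF.
Qed.

(** Here [t = n] is allowed, since the actions of day [t] are chosen before the departures of that
    day are seen. *)
Lemma unbought_flat n t m : (t <= n)%N ->
  unbought (flat n) t m = unbought (flat t) t m.
Proof.
elim: t => // t IH tn; rewrite !unboughtS.
rewrite (play_flat (hist_flat tn (ltnSn t)))//.
by rewrite {1}/unbought (hist_flat tn (ltnSn t)).
Qed.

End Flat.
End Process.

(** * Lower bounds on the cost of one day, for a fixed policy *)

Section Costs.
Variables (R : realType) (M B G : nat) (pi : policy M) (N : instance M).
Local Notation cost := (action_cost R B G).
Local Notation act t := (play pi N (hist pi N t)).
Local Notation ub t m := ((unbought pi N t m)%:R : R).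

Lemma day_cost_ge (p : R) t m : (t < N m)%N -> p <= B%:R ->
  (act t m = Some Defs.Group -> p <= G%:R / #|[pred n | act t n == Some Defs.Group]|%:R) ->
  ub t.+1 m + p * (ub t m - ub t.+1 m) <= cost (act t) m.
Proof.
move=> tN pB; rewrite /action_cost unboughtS playE tN !inE /=.
case: (unbought pi N t m) => /=; last by rewrite subrr mulr0 addr0.
by case: (pi _ m) => /= [_|_|/(_ erefl)]; rewrite /= ?subrr ?mulr0 ?addr0 ?add0r ?subr0 ?mulr1.
Qed.

(** Makes the cost a function of the history of [n] days, the form from which integrability is
    drawn. *)
Lemma agent_cost_hist r0 m n : (N m <= n)%N ->
  agent_cost R B G m N pi =
  \sum_(t < n) cost (nth r0 (hist pi N n) t).1 m.
Proof.
move=> Nn; rewrite /agent_cost (big_ord_widen n (fun t => cost (act t) m))//.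
rewrite big_mkcond; apply: eq_bigr => t _; rewrite nth_hist//.
by case: ifP => // tN; rewrite /action_cost playE tN.
Qed.

End Costs.

Lemma sum_late (R : realType) (M l : nat) (a : R) : (l <= M)%N ->
  \sum_(m < M | (l <= m)%N) a = (M - l)%:R * a.
Proof.
by move=> lM; rewrite -(big_geq_mkord _ _ xpredT (fun=> a)) sumr_const_nat mulr_natl.
Qed.

Lemma card_late (M l : nat) : (l <= M)%N -> #|[pred m : 'I_M | (l <= m)%N]| = (M - l)%N.
Proof.
move=> lM; rewrite -sum1_card -(big_geq_mkord _ _ xpredT (fun=> 1%N)).
by rewrite sum_nat_const_nat muln1.
Qed.

(** At most [M - l] of the buyers are late, and the right-hand side is all of [G] once somebody
    buys. *)
Lemma group_share_le (R : realType) (M l G : nat) (P : pred 'I_M) : (l <= M)%N ->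
  (G%:R / (M - l)%:R : R) *+ #|[pred m in P | (l <= m)%N]| <=
  (G%:R / #|P|%:R : R) *+ #|P|.
Proof.
move=> lM; have [K0|] := posnP #|[pred m in P | (l <= m)%N]|.
  by rewrite K0 mulr0n mulrn_wge0// divr_ge0.
move=> K0; have P0 : (0 < #|P|)%N.
  by apply: leq_trans K0 _; apply: subset_leq_card; apply/fintype.subsetP => m; rewrite inE => /andP[].
rewrite -[leLHS]mulr_natr -[leRHS]mulr_natr divfK ?pnatr_eq0 -?lt0n//.
have Kl : (#|[pred m in P | (l <= m)%N]| <= M - l)%N.
  rewrite -card_late//; apply: subset_leq_card; apply/fintype.subsetP => m.
  by rewrite !inE => /andP[].
rewrite mulrAC ler_pdivrMr ?ltr0n ?(leq_trans K0)//.
by rewrite ler_wpM2l// ler_nat.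
Qed.

Section FlatCosts.
Variables (R : realType) (M B G : nat) (pi : policy M) (s : seq nat).
Hypothesis sM : (size s < M)%N.
Local Notation l := (size s).
Local Notation flat := (flat_instance s).
Local Notation cost := (action_cost R B G).
Local Notation act n t := (play pi (flat n) (hist pi (flat n) t)).
Local Notation ub n t m := ((unbought pi (flat n) t m)%:R : R).
Local Notation price := (Num.min B%:R (G%:R / (M - l)%:R) : R).

Lemma flat_late n (m : 'I_M) : (l <= m)%N -> flat n m = n.
Proof. by rewrite /flat_instance leqNgt => /negbTE ->. Qed.

Lemma card_group_late n t (m : 'I_M) : all (fun k => k <= t)%N s ->
  act n t m = Some Defs.Group ->
  (0 < #|[pred i | act n t i == Some Defs.Group]| <= M - l)%N.
Proof.
move=> /allP st am; apply/andP; split.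
  by apply/card_gt0P; exists m; rewrite inE am.
rewrite -card_late; last exact: ltnW.
apply: subset_leq_card; apply/fintype.subsetP => i; rewrite !inE playE.
have [//|il] := leqP l i.
by rewrite {1}/flat_instance il ltnNge st ?mem_nth.
Qed.

Lemma day_cost_late n t (m : 'I_M) : all (fun k => k <= t)%N s -> (t < n)%N ->
  (l <= m)%N ->
  ub n t.+1 m + price * (ub n t m - ub n t.+1 m) <= cost (act n t) m.
Proof.
move=> st tn lm; apply: day_cost_ge; rewrite ?flat_late ?ge_min ?lexx// => am.
apply/orP; right; have /andP[k0 kl] := card_group_late st am.
by rewrite ler_wpM2l// lef_pV2 ?posrE ?ltr0n// ?ler_nat// subn_gt0.
Qed.

(** Early agents may still share the pass, but at most [M] agents do, so a share is at least
    [G / M], which exceeds [B / M]. *)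
Lemma day_cost_early n t (m : 'I_M) : (t < n)%N -> (B < G)%N -> (l <= m)%N ->
  ub n t.+1 m + B%:R / M%:R * (ub n t m - ub n t.+1 m) <= cost (act n t) m.
Proof.
have M0 : (0 < M)%N by apply: leq_ltn_trans sM.
move=> tn BG lm; apply: day_cost_ge; rewrite ?flat_late//.
  by rewrite ler_pdivrMr ?ltr0n// -natrM ler_nat leq_pmulr.
move=> am; have k0 : (0 < #|[pred i | act n t i == Some Defs.Group]|)%N.
  by apply/card_gt0P; exists m; rewrite inE am.
apply: ler_pM; rewrite ?invr_ge0 ?ler_nat ?(ltnW BG)//.
by rewrite lef_pV2 ?posrE ?ltr0n// ler_nat -[leqRHS]card_ord max_card.
Qed.

(* A group pass costs [G] in total, however many of the agents that are about
   to leave take part in it; hence it may be charged to the late agents. *)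
Lemma day_cost_total n t : (t < n)%N ->
  \sum_(m < M | (l <= m)%N) (ub n t.+1 m + price * (ub n t m - ub n t.+1 m)) <=
  \sum_(m < M) cost (act n t) m.
Proof.
move=> tn; set A := [pred i | act n t i == Some Defs.Group].
(* [ind] is the share actually paid for the group pass, [shr] the notional share of a pass split
   among the late agents alone; replacing the one by the other can only lower the total. *)
pose ind m : R := G%:R / #|A|%:R *+ (m \in A).
pose shr m : R := G%:R / (M - l)%:R *+ (m \in A).
have ind_le m : ind m <= cost (act n t) m.
  rewrite /ind /action_cost inE; case: (act n t m) => [[]|] //=.
apply: (@le_trans _ _
  (\sum_(m < M | (l <= m)%N) (cost (act n t) m - ind m) +
   \sum_(m < M | (l <= m)%N) shr m)).
  rewrite -big_split/=; apply: ler_sum => m lm.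
  rewrite /ind /shr /action_cost inE unboughtS playE flat_late// tn /=.
  case: (unbought pi _ t m) => /=; last by lra.
  case: (pi _ m); rewrite !inE/= ?mulr0n ?mulr1n.
  - lra.
  - by have : price <= B%:R by [rewrite ge_min lexx]; lra.
  - have : price <= G%:R / (M - l)%:R by rewrite ge_min lexx orbT.
    lra.
have -> : \sum_(m < M | (l <= m)%N) shr m = (G%:R / (M - l)%:R) *+ #|[pred m in A | (l <= m)%N]|.
  rewrite /shr -sumr_const big_mkcond [RHS]big_mkcond; apply: eq_bigr => m _.
  by rewrite !inE andbC; case: (l <= m)%N => //=; case: (_ == _).
apply: (@le_trans _ _ (\sum_(m < M) (cost (act n t) m - ind m) + \sum_(m < M) ind m)).
  apply: lerD.
    rewrite [leRHS](bigID (fun m : 'I_M => (l <= m)%N))/= lerDl.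
    by apply: sumr_ge0 => m _; rewrite subr_ge0.
  rewrite (_ : \sum_(m < M) ind m = G%:R / #|A|%:R *+ #|A|); first exact/group_share_le/ltnW.
  rewrite /ind -[RHS]sumr_const big_mkcond [RHS]big_mkcond; apply: eq_bigr => m _.
  by case: (m \in A).
by rewrite -big_split/=; apply: ler_sum => m _; rewrite subrK.
Qed.

End FlatCosts.

(** * Measurability and expected costs *)

Section Expectation.
Local Open Scope classical_set_scope.
Variables (R : realType) (M : nat) (f : randomized_policy R M).
Implicit Type N : instance M.
Local Notation policies := (g_sigma_algebraType (@policy_cylinders M)).

(** By induction on [t]: beyond the event for the earlier history, the last record constrains only
    finitely many decisions, and departures do not depend on the policy. *)
Lemma measurable_hist_eq N t (h : history M) :
  measurable ([set pi | hist pi N t = h] : set policies).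
Proof.
have mP (P : Prop) : measurable ([set _ | P] : set policies).
  have [p|p] := pselect P.
    by rewrite (_ : [set _ | P] = setT) //; apply/seteqP; split.
  by rewrite (_ : [set _ | P] = set0) //; apply/seteqP; split.
elim: t h => [|t IH] h /=; first exact: mP.
case/lastP: h => [|h r].
  rewrite (_ : [set _ | _] = set0)//; apply/seteqP; split => // pi /= /(congr1 size).
  by rewrite size_rcons.
rewrite (_ : [set _ | _] = [set pi | hist pi N t = h] `&`
    ((\bigcap_(m in [set: 'I_M]) [set pi | play pi N h m = r.1 m]) `&`
     [set _ | [set m | N m == t.+1]%SET = r.2])).
  apply: measurableI => //; apply: measurableI => //.
  apply: fin_bigcap_measurable => // m _.
  rewrite (_ : [set _ | _] = [set pi : policies |
    (if (size h < N m)%N && ~~ has_pass h m then Some (pi h m) else None) = r.1 m]).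
    case: ((size h < N m)%N && ~~ has_pass h m); last exact: mP.
    case: (r.1 m) => [d|]; last first.
      by rewrite (_ : [set _ | _] = set0)//; apply/seteqP; split.
    apply: (@sub_sigma_algebra _ setT (@policy_cylinders M)); exists h, m, d.
    by apply/seteqP; split => pi /= => [[]|->].
  by apply/seteqP; split => pi; rewrite /= ffunE.
apply/seteqP; split => pi /=.
  move=> /rcons_inj[hh rr]; rewrite -hh -rr; split => //; split => //.
move=> [-> [pl X]]; congr rcons; rewrite [r]surjective_pairing -X; congr pair.
by apply/ffunP => m; apply: pl.
Qed.

Lemma measurable_fun_hist N t (phi : history M -> R) :
  measurable_fun [set: policies] (fun pi => phi (hist pi N t)).
Proof.
move=> _ Y _; rewrite setTI.
rewrite (_ : _ @^-1` _ =
    \bigcup_h ([set pi | hist pi N t = h] `&` [set pi | Y (phi h)])).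
  apply: countable_bigcupT_measurable; first exact: countableP.
  move=> h; have [p|p] := pselect (Y (phi h)).
    rewrite (_ : [set _ | Y _] = setT) ?setIT; first exact: measurable_hist_eq.
    by apply/seteqP; split.
  by rewrite (_ : [set _ | Y _] = set0) ?setI0//; apply/seteqP; split.
apply/seteqP; split => pi /=; first by move=> Yp; exists (hist pi N t).
by move=> [h _ [<-]].
Qed.

Lemma integrable_hist N t (phi : history M -> R) :
  f.-integrable [set: policies] (EFin \o (fun pi => phi (hist pi N t))).
Proof.
apply: measurable_bounded_integrable => //.
- by rewrite /= probability_setT ltry.
- exact: measurable_fun_hist.
(* There are finitely many histories of length [t], so summing over all of them gives a uniform
   bound. *)
exists (\sum_(h : t.-tuple (day_record M)) `|phi h|); split; first exact: num_real.
move=> x /ltW bx pi _; apply: le_trans bx.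
have ht : size (hist pi N t) == t by rewrite size_hist.
by rewrite (bigD1 (Tuple ht))//= lerDl sumr_ge0.
Qed.

Definition integrableR (X : policies -> R) :=
  f.-integrable [set: policies] (EFin \o X).

Lemma integrableR_sum (I : Type) (r : seq I) (P : pred I) (F : I -> policies -> R) :
  (forall i, integrableR (F i)) ->
  integrableR (fun pi => \sum_(i <- r | P i) F i pi).
Proof.
move=> iF; rewrite /integrableR (_ : _ \o _ =
  fun pi => (\sum_(i <- r | P i) (F i pi)%:E)%E); first by apply: integrable_sum => // i _; exact: iF.
by apply/funext => pi /=; rewrite sumEFin.
Qed.

Lemma Rintegral_sum (I : Type) (r : seq I) (P : pred I) (F : I -> policies -> R) :
  (forall i, integrableR (F i)) ->
  \int[f]_pi (\sum_(i <- r | P i) F i pi) = \sum_(i <- r | P i) \int[f]_pi F i pi.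
Proof.
move=> iF; elim: r => [|i r IH].
  under eq_Rintegral do rewrite big_nil.
  by rewrite big_nil Rintegral_cst// mul0r.
under eq_Rintegral do rewrite big_cons.
rewrite big_cons; case: (P i) => //.
rewrite RintegralD// ?IH//; [exact: iF|exact: (integrableR_sum r P iF)].
Qed.

Lemma expectation_hist_ge N t (phi : history M -> R) (X Y : policies -> R) :
  integrableR Y -> (forall pi, X pi = phi (hist pi N t)) ->
  (forall pi, Y pi <= X pi) ->
  ((\int[f]_pi Y pi)%:E <= 'E_f[X])%E.
Proof.
move=> iY /funext-> YX.
have iX := integrable_hist N t phi.
rewrite unlock -(fineK (integrable_fin_num _ iX))// lee_fin.
by apply: le_Rintegral => // pi _; exact: YX.
Qed.

Lemma integrable_unbought N t m :
  integrableR (fun pi => (unbought pi N t m)%:R).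
Proof. exact: (integrable_hist N t (fun h => (~~ has_pass h m)%:R)). Qed.

Lemma day_integrable N t m p :
  integrableR (fun pi => (unbought pi N t.+1 m)%:R +
    p * ((unbought pi N t m)%:R - (unbought pi N t.+1 m)%:R)).
Proof.
have i0 := integrable_unbought N t m; have i1 := integrable_unbought N t.+1 m.
exact: (integrableD measurableT i1
  (integrableZl measurableT p (integrableB measurableT i0 i1))).
Qed.

Lemma Rintegral_day N t m p :
  \int[f]_pi ((unbought pi N t.+1 m)%:R +
    p * ((unbought pi N t m)%:R - (unbought pi N t.+1 m)%:R)) =
  \int[f]_pi (unbought pi N t.+1 m)%:R +
  p * (\int[f]_pi (unbought pi N t m)%:R - \int[f]_pi (unbought pi N t.+1 m)%:R).
Proof.
have i0 := integrable_unbought N t m; have i1 := integrable_unbought N t.+1 m.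
have iB : integrableR (fun pi => (unbought pi N t m)%:R - (unbought pi N t.+1 m)%:R).
  exact: (integrableB measurableT i0 i1).
rewrite RintegralD//; last exact: (integrableZl measurableT p iB).
by rewrite RintegralZl// RintegralB.
Qed.

Variable s : seq nat.
Local Notation flat := (flat_instance s).

(** The probability that agent [m] has no pass after [t] days; by [survival_flat] every longer
    horizon gives the same value. *)
Definition survival (m : 'I_M) (t : nat) : R :=
  \int[f]_pi (unbought pi (flat t) t m)%:R.

Lemma survival_flat n m t : (t <= n)%N ->
  \int[f]_pi (unbought pi (flat n) t m)%:R = survival m t.
Proof. by move=> tn; apply: eq_Rintegral => pi _; rewrite unbought_flat. Qed.

Lemma survival0 m : survival m 0 = 1.
Proof. by rewrite /survival Rintegral_cst//= probability_setT mulr1. Qed.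

Lemma survival_ge0 m t : 0 <= survival m t.
Proof. exact: Rintegral_ge0. Qed.

Lemma survivalS m t : survival m t.+1 <= survival m t.
Proof.
rewrite -(survival_flat _ (leqnSn t)); apply: le_Rintegral => //.
- exact: integrable_unbought.
- exact: integrable_unbought.
by move=> pi _; rewrite ler_nat unboughtS; case: (unbought _ _ _ _); case: (_ \notin _).
Qed.

Variables (B G : nat).

Lemma flat_le n (m : 'I_M) : all (fun k => k <= n)%N s -> (flat n m <= n)%N.
Proof.
by move=> /allP sn; rewrite /flat_instance; case: ltnP => // ms; rewrite sn ?mem_nth.
Qed.

(** The price varies with the day because a group share can be cheaper while early agents are
    active. *)
Lemma Cost_agent_ge n (m : 'I_M) (price : nat -> R) :
  all (fun k => k <= n)%N s ->
  (forall pi (t : 'I_n),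
    (unbought pi (flat n) t.+1 m)%:R + price t *
      ((unbought pi (flat n) t m)%:R - (unbought pi (flat n) t.+1 m)%:R) <=
    action_cost R B G (play pi (flat n) (hist pi (flat n) t)) m) ->
  ((\sum_(t < n) (survival m t.+1 + price t * (survival m t - survival m t.+1)))%:E
   <= Cost_agent B G f m (flat n))%E.
Proof.
move=> sn le_day; have r0 : day_record M := ([ffun=> None], finset.set0).
rewrite (_ : \sum_(t < n) _ = \int[f]_pi
    (\sum_(t < n) ((unbought pi (flat n) t.+1 m)%:R + price t *
      ((unbought pi (flat n) t m)%:R - (unbought pi (flat n) t.+1 m)%:R)))).
  apply: (@expectation_hist_ge (flat n) n
    (fun h => \sum_(t < n) action_cost R B G (nth r0 h t).1 m)).
  - by apply: integrableR_sum => t; exact: day_integrable.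
  - by move=> pi; exact/agent_cost_hist/flat_le.
  move=> pi; rewrite (agent_cost_hist R B G pi r0 (flat_le m sn)).
  by apply: ler_sum => t _; rewrite nth_hist.
rewrite Rintegral_sum; last by move=> t; exact: day_integrable.
by apply: eq_bigr => t _; rewrite Rintegral_day !survival_flat// ltnW.
Qed.

Lemma Cost_ge n (price : R) :
  all (fun k => k <= n)%N s ->
  (forall pi (t : 'I_n), \sum_(m < M | (size s <= m)%N)
    ((unbought pi (flat n) t.+1 m)%:R + price *
      ((unbought pi (flat n) t m)%:R - (unbought pi (flat n) t.+1 m)%:R)) <=
    \sum_(m < M) action_cost R B G (play pi (flat n) (hist pi (flat n) t)) m) ->
  ((\sum_(t < n) \sum_(m < M | (size s <= m)%N)
     (survival m t.+1 + price * (survival m t - survival m t.+1)))%:E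
   <= Cost B G f (flat n))%E.
Proof.
move=> sn le_day; have r0 : day_record M := ([ffun=> None], finset.set0).
rewrite (_ : \sum_(t < n) _ = \int[f]_pi
    (\sum_(t < n) \sum_(m < M | (size s <= m)%N)
      ((unbought pi (flat n) t.+1 m)%:R + price *
      ((unbought pi (flat n) t m)%:R - (unbought pi (flat n) t.+1 m)%:R)))).
  apply: (@expectation_hist_ge (flat n) n
    (fun h => \sum_(m < M) \sum_(t < n) action_cost R B G (nth r0 h t).1 m)).
  - by apply: integrableR_sum => t; apply: integrableR_sum => m; exact: day_integrable.
  - by move=> pi; apply: eq_bigr => m _; exact/agent_cost_hist/flat_le.
  move=> pi; rewrite /total_cost.
  under [leRHS]eq_bigr => m _ do rewrite (agent_cost_hist R B G pi r0 (flat_le m sn)).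
  rewrite [leRHS]exchange_big/=; apply: ler_sum => t _; apply: le_trans (le_day pi t) _.
  by apply: ler_sum => m _; rewrite nth_hist.
rewrite Rintegral_sum; last first.
  by move=> t; apply: integrableR_sum => m; exact: day_integrable.
apply: eq_bigr => t _; rewrite Rintegral_sum; last by move=> m; exact: day_integrable.
by apply: eq_bigr => m _; rewrite Rintegral_day !survival_flat// ltnW.
Qed.

End Expectation.

(** * The benchmarks on the adversary's instances *)

Section Benchmarks.
Variables (R : realType) (M B G : nat) (s : seq nat).
Hypotheses (sM : (size s < M)%N) (B0 : (0 < B)%N) (G0 : (0 < G)%N).
Local Notation l := (size s).
Local Notation flat := (@flat_instance M s).
Local Notation price := (Num.min B%:R (G%:R / (M - l)%:R) : R).

(** [sumn s] serves as a crude bound on the entries of [s], so a larger [n] keeps the instance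
    monotone. *)
Lemma flat_instances n : all (fun k => 0 < k)%N s -> sorted leq s ->
  (sumn s < n)%N -> instances s (flat n).
Proof.
move=> s0 ss sn; have le_sn i : (nth 0%N s i <= n)%N.
  have [il|?] := ltnP i l; last by rewrite nth_default.
  by rewrite (leq_trans _ (ltnW sn))// sumnE (big_rem (nth 0%N s i)) ?mem_nth ?leq_addr.
split; last split.
- move=> m; rewrite /flat_instance; case: (ltnP m l) => [ml|_]; last exact: leq_ltn_trans (leq0n _) sn.
  exact: (allP s0) (mem_nth _ _).
- move=> i j ij; rewrite /flat_instance.
  case: (ltnP i l) => il; case: (ltnP j l) => jl //.
    by apply: (sorted_leq_nth leq_trans leqnn) => //.
  by move: (leq_trans il ij); rewrite leqNgt jl.
- by move=> m ml; rewrite /flat_instance ml.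
Qed.

Lemma sum_early n : \sum_(m < M | (m < l)%N) (flat n m)%:R = (sumn s)%:R :> R.
Proof.
rewrite sumnE (big_nth 0%N) big_mkord natr_sum.
rewrite (big_ord_widen_cond M xpredT (fun i => (nth 0%N s i)%:R)); last exact: ltnW.
by apply: eq_bigr => m ml; rewrite /flat_instance ml.
Qed.

Lemma min_price n : Num.min (G%:R : R) ((M - l)%:R * Num.min n%:R B%:R) =
  (M - l)%:R * Num.min price n%:R.
Proof.
have K0 : (0 : R) < (M - l)%:R by rewrite ltr0n subn_gt0.
rewrite -[G%:R in LHS](@divfK _ (M - l)%:R) ?gt_eqF// [_ * (M - l)%:R]mulrC.
rewrite -minr_pMr ?ltW//; congr (_ * _).
by rewrite minC -minA minC.
Qed.

Lemma OPT_SD_flat n :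
  OPT_SD R B G (flat n) s = (sumn s)%:R + (M - l)%:R * Num.min price n%:R.
Proof.
rewrite /OPT_SD sum_early -min_price -sum_late 1?ltnW//.
by congr (_ + Num.min _ _); apply: eq_bigr => m lm; rewrite flat_late.
Qed.

(** Capping the early terms at [B] and moving their sum under the minimum with [G] only lowers the
    value, so the overall optimum is at most the state-dependent one. *)
Lemma OPT_OV_flat n :
  OPT_OV R B G (flat n) <= (sumn s)%:R + (M - l)%:R * Num.min price n%:R.
Proof.
rewrite -OPT_SD_flat /OPT_OV /OPT_SD.
rewrite (bigID (fun m : 'I_M => (m < l)%N))/=.
set a := \sum_(m < M | (m < l)%N) _; set b := \sum_(m < M | ~~ _) _.
set a' := \sum_(m < M | (m < l)%N) _; set b' := \sum_(m < M | _) _.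
have a'0 : 0 <= a' by apply: sumr_ge0.
have aa' : a <= a' by apply: ler_sum => m _; rewrite ge_min lexx orbT.
have <- : b = b' by apply: eq_big => m; rewrite -?leqNgt// minC.
rewrite addr_minr le_min; apply/andP; split; rewrite ge_min; apply/orP.
  by left; lra.
by right; lra.
Qed.

Lemma OPT_SD_gt0 n : (0 < n)%N -> 0 < OPT_SD R B G (flat n) s.
Proof.
move=> n0; rewrite OPT_SD_flat ltr_wpDl// mulr_gt0 ?ltr0n ?subn_gt0//.
by rewrite !lt_min ?divr_gt0 ?ltr0n ?subn_gt0// B0.
Qed.

Lemma OPT_OV_gt0 (N : instance M) : (forall m, 0 < N m)%N -> 0 < OPT_OV R B G N.
Proof.
move=> N0; rewrite lt_min ltr0n G0/= (bigD1 (Ordinal sM))//= ltr_wpDr//.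
  by apply: sumr_ge0 => m _; rewrite le_min !ler0n.
by rewrite lt_min !ltr0n B0 N0.
Qed.

Lemma threshold_gt0 j : 0 < threshold R M B G j.
Proof.
rewrite /threshold; case: ltnP => jM; last by rewrite ltr0n.
by rewrite lt_min divr_gt0 ?ltr0n ?subn_gt0.
Qed.

Lemma threshold_homo i j : (i <= j < M)%N ->
  threshold R M B G i <= threshold R M B G j.
Proof.
move=> /andP[ij jM]; rewrite /threshold jM (leq_ltn_trans ij jM).
rewrite le_min ge_min ?lexx ?ge_min ?lexx ?orbT ?andbT.
rewrite ler_wpM2l// lef_pV2 ?posrE ?ltr0n ?subn_gt0// ?(leq_ltn_trans ij jM)//.
by rewrite ler_nat leq_sub2l.
Qed.

Lemma lstar_le (N : instance M) (m : 'I_M) :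
  threshold R M B G m < (N m)%:R -> (lstar R B G N <= m)%N.
Proof.
rewrite /lstar; elim: (index_enum _) (mem_index_enum m) => // i r IH.
rewrite big_cons inE => /predU1P[<-|mr] mN; first by rewrite mN geq_minl.
by case: ifP => _; rewrite ?geq_min IH ?orbT.
Qed.

Lemma OPT_IND_gt0 (N : instance M) m : (0 < N m)%N -> 0 < OPT_IND R B G N m.
Proof.
by move=> N0; rewrite /OPT_IND; case: ifP => _; rewrite ?ltr0n ?threshold_gt0.
Qed.

(** If [price < n], the first late agent, of index [l], meets the condition defining [lstar]; so
    [lstar <= l], and by monotonicity the threshold there is at most its value [price] at [l]. *)
Lemma OPT_IND_flat n (m : 'I_M) : (l <= m)%N ->
  OPT_IND R B G (flat n) m <= Num.min price n%:R.
Proof.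
move=> lm; rewrite /OPT_IND flat_late//.
have thl : threshold R M B G l = price by rewrite /threshold sM minC.
have th : price < n%:R -> threshold R M B G (lstar R B G (flat n)) <= price.
  move=> pn; rewrite -thl; apply: threshold_homo; rewrite sM andbT.
  by apply: (@lstar_le _ (Ordinal sM)); rewrite flat_late //= thl.
rewrite -minEle le_min [in X in _ && X]ge_min lexx andbT ge_min.
by case: (leP n%:R price) => //= /th.
Qed.

End Benchmarks.

(** * From a small ratio to a contradiction *)

Lemma ereal_sup_ratio_le (R : realType) (T : Type) (A : set T)
    (g : T -> \bar R) (h : T -> R) (c b u : R) (N : T) :
  (ereal_sup [set (g N / (h N)%:E)%E | N in A] < c%:E)%E ->
  A N -> 0 <= c -> 0 < h N -> (b%:E <= g N)%E -> h N <= u -> b <= c * u.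
Proof.
move=> supc AN c0 h0 bg hu.
have := @ereal_sup_ubound _ [set (g N / (h N)%:E)%E | N in A]%classic (g N / (h N)%:E)%E.
move=> /(_ (ex_intro2 _ _ N AN erefl)) /le_lt_trans /(_ supc) /ltW.
rewrite inver gt_eqF// lee_pdivrMr// -EFinM => /(le_trans bg).
by rewrite lee_fin => /le_trans; apply; rewrite ler_wpM2l.
Qed.

Lemma telescope_days (R : realType) (x : nat -> R) (p : R) n :
  \sum_(t < n) (x t.+1 + p * (x t - x t.+1)) =
  \sum_(t < n) x t.+1 + p * (x 0 - x n).
Proof.
elim: n => [|n IH]; first by rewrite !big_ord0 subrr mulr0 addr0.
by rewrite !big_ord_recr/= IH; ring.
Qed.

Lemma telescope_two_prices (R : realType) (x : nat -> R) (p' p : R) n0 n :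
  (n0 <= n)%N ->
  \sum_(t < n) (x t.+1 + (if (t < n0)%N then p' else p) * (x t - x t.+1)) =
  \sum_(t < n) x t.+1 + p' * (x 0 - x n0) + p * (x n0 - x n).
Proof.
move=> /subnKC <-; elim: (n - n0)%N => [|k IH].
  rewrite addn0 subrr mulr0 addr0 -telescope_days; apply: eq_bigr => t _.
  by rewrite ltn_ord.
by rewrite addnS !big_ord_recr/= IH ltnNge leq_addr/=; ring.
Qed.

Theorem lemma10 (R : realType) (M : nat) (s : seq nat) (hs : is_state M s)
    (eps : R) (heps : 0 < eps) :
  exists B0 : nat, forall B G : nat,
    (B0 <= B)%N -> (B < G)%N -> (G < M * B)%N ->
    forall f : randomized_policy R M,
      [/\ ((expR 1 / (expR 1 - 1) - eps)%:E <= CR_OV B G f s)%E,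
          ((expR 1 / (expR 1 - 1) - eps)%:E <= CR_SD B G f s)%E
        & forall m : 'I_M, (size s <= m)%N ->
          ((expR 1 / (expR 1 - 1) - eps)%:E <= CR_IND B G f m s)%E].
Proof.
have /and3P[sM s0 ss] := hs.
have e1 : 1 < expR 1 :> R by rewrite expR_gt1.
set e := expR 1 in e1 *.
(* [c] lies just below the target. Cutting [eps] at [(e - 1)^-1] keeps [c >= 1], since
   [e / (e - 1) - 1 / (e - 1) = 1]; [d] is the gap [e - (e - 1) * c]. *)
pose c := e / (e - 1) - Num.min eps (e - 1)^-1.
pose d := (e - 1) * Num.min eps (e - 1)^-1.
have e0 : 0 < (e - 1)^-1 by rewrite invr_gt0 subr_gt0.
have d0 : 0 < d by rewrite mulr_gt0 ?subr_gt0// lt_min heps.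
have eE : (e - 1) * (e - 1)^-1 = 1 by rewrite mulfV// gt_eqF// subr_gt0.
have cd : e - (e - 1) * c = d.
  rewrite /c /d; set u := Num.min _ _; move: eE; set v := (e - 1)^-1 => eE.
  have -> : e - (e - 1) * (e * v - u) = e - e * ((e - 1) * v) + (e - 1) * u by ring.
  by rewrite eE; ring.
have c1 : 1 <= c.
  have : Num.min eps (e - 1)^-1 <= (e - 1)^-1 by rewrite ge_min lexx orbT.
  rewrite /c; set u := Num.min _ _; move: eE; set v := (e - 1)^-1; lra.
have c0 : 0 <= c by lra.
have ce : e / (e - 1) - eps <= c by rewrite /c lerD2l lerN2 ge_min lexx.
(* By day [n0] all early agents have left; [C] absorbs early rents and early purchases. *)
pose n0 := (sumn s).+1.
pose C := M%:R * (c * n0%:R).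
have M0 : 0 < M%:R :> R by rewrite ltr0n (leq_ltn_trans _ sM).
have M1 : 1 <= M%:R :> R by rewrite ler1n (leq_ltn_trans _ sM).
have cn0 : 0 <= c * n0%:R by rewrite mulr_ge0.
have C0 : 0 <= C by rewrite mulr_ge0// ltW.
(* [Q] is the right-hand side of the survival bound, so [p > T] contradicts [(p - 1) * d <= Q]; the
   summands [1] and [n0] in [T] secure [1 < p] and [n0 <= p]. *)
pose Q := c + e * (c - 1 + c * n0%:R + C).
have Q0 : 0 <= Q by rewrite /Q; nra.
pose T := Q / d + 1 + n0%:R.
have T1 : 0 < T by rewrite /T; have := divr_ge0 Q0 (ltW d0); have : (0 : R) <= n0%:R by []; lra.
(* This makes [B / M], a lower bound of [p], exceed [T]. *)
exists (Num.trunc (M%:R * T)).+1 => B G BT BG GMB f.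
have B0 : (0 < B)%N by apply: leq_trans BT.
have G0 : (0 < G)%N by apply: leq_trans BG.
pose K := (M - size s)%N.
have K0 : 0 < K%:R :> R by rewrite ltr0n subn_gt0.
pose p : R := Num.min B%:R (G%:R / K%:R).
pose p' : R := B%:R / M%:R.
have Tp' : T < p'.
  rewrite ltr_pdivlMr// mulrC (lt_le_trans (truncnS_gt _))// ler_nat.
  exact: BT.
have p'p : p' <= p.
  rewrite le_min; apply/andP; split.
    by rewrite ler_pdivrMr// ler_peMr.
  apply: ler_pM; rewrite ?invr_ge0 ?ler_nat ?(ltnW BG)//.
  by rewrite lef_pV2 ?posrE// ler_nat leq_subr.
have Qd : 0 <= Q / d by rewrite divr_ge0// ltW.
have n00 : (0 : R) <= n0%:R by [].
have absurd_survival (x : nat -> R) :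
    (forall n, 0 <= x n) -> (forall n, x n.+1 <= x n) ->
    (forall n, (n0 <= n)%N ->
      \sum_(t < n) x t.+1 + p * (1 - x n) <= c * Num.min p n%:R + C) -> False.
  move=> x0 xS ub.
  have p1 : 1 < p by move: Tp' p'p; rewrite /T; lra.
  have pn0 : n0%:R <= p by move: Tp' p'p; rewrite /T; lra.
  have := ski_rental_survival_bound p1 c1 C0 pn0 x0 xS ub.
  rewrite -/e cd -/Q; apply/negP; rewrite -ltNge -ltr_pdivrMr//.
  by move: Tp' p'p; rewrite /T; lra.
have inst n : (n0 <= n)%N -> instances s (flat_instance s n : instance M).
  by move=> nn; apply: flat_instances.
have sn n : (n0 <= n)%N -> all (fun k => k <= n)%N s.
  move=> nn; apply/allP => k ks; apply: leq_trans nn; apply: leqW.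
  by rewrite sumnE (big_rem k)//= leq_addr.
(* Common to [CR_OV] and [CR_SD]: survival is averaged over the late agents, and [c] times the early
   days is at most [C]. *)
have total_absurd (opt : instance M -> R) :
    (ereal_sup [set (Cost B G f N / (opt N)%:E)%E | N in @instances M s] < c%:E)%E ->
    (forall n, (n0 <= n)%N -> 0 < opt (flat_instance s n)) ->
    (forall n, opt (flat_instance s n) <=
               (sumn s)%:R + K%:R * Num.min p n%:R) -> False.
  move=> supc opt0 optU.
  pose X t := (\sum_(m < M | (size s <= m)%N) survival f s m t) / K%:R.
  have XK t : \sum_(m < M | (size s <= m)%N) survival f s m t = K%:R * X t.
    by rewrite /X mulrC divfK// gt_eqF.
  have X0 : X 0 = 1.
    rewrite /X; under eq_bigr do rewrite survival0.
    by rewrite sum_late 1?ltnW// mulr1 divff// gt_eqF.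
  apply: (absurd_survival X) => [n|n|n nn].
  - by apply: divr_ge0; [apply: sumr_ge0 => m _; exact: survival_ge0|exact: ltW].
  - apply: ler_wpM2r; first by rewrite invr_ge0 ltW.
    by apply: ler_sum => m _; exact: survivalS.
  have H := Cost_ge f (sn n nn)
    (fun pi (t : 'I_n) => day_cost_total R B G pi sM (ltn_ord t)).
  have := ereal_sup_ratio_le supc (inst n nn) c0 (opt0 n nn) H (optU n).
  under eq_bigr => t _.
    rewrite big_split/= -mulr_sumr sumrB !XK -/K -/p.
    rewrite (_ : _ + _ = K%:R * (X t.+1 + p * (X t - X t.+1))); last by ring.
    over.
  rewrite -mulr_sumr telescope_days X0 => {}H.
  have sC : c * (sumn s)%:R <= C.
    have : (sumn s)%:R <= n0%:R :> R by rewrite ler_nat leqnSn.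
    by rewrite /C; nra.
  have K1 : 1 <= K%:R :> R by rewrite ler1n subn_gt0.
  rewrite -(ler_pM2l K0) (le_trans H)// !mulrDr.
  have : C <= K%:R * C by rewrite ler_peMl.
  lra.
split.
- apply: le_trans (_ : c%:E <= _)%E; first by rewrite lee_fin.
  rewrite leNgt; apply/negP => /total_absurd; apply.
    by move=> n nn; apply: (OPT_OV_gt0 R sM B0 G0); case: (inst n nn).
  by move=> n; exact: OPT_OV_flat.
- apply: le_trans (_ : c%:E <= _)%E; first by rewrite lee_fin.
  rewrite leNgt; apply/negP => /total_absurd; apply.
    by move=> n nn; apply: OPT_SD_gt0 => //; exact: leq_trans nn.
  by move=> n; rewrite OPT_SD_flat.
move=> m lm; apply: le_trans (_ : c%:E <= _)%E; first by rewrite lee_fin.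
rewrite leNgt; apply/negP => supc.
pose x := survival f s m.
have xS n : x n.+1 <= x n by exact: survivalS.
have x0E : x 0 = 1 by exact: survival0.
(* On the first [n0] days only the price [p' = B / M] is certain, afterwards [p]. *)
have bound n : (n0 <= n)%N ->
    \sum_(t < n) x t.+1 + p' * (1 - x n0) + p * (x n0 - x n) <=
    c * Num.min p n%:R.
  move=> nn; have := telescope_two_prices x p' p nn; rewrite x0E => <-.
  apply: (ereal_sup_ratio_le supc (inst n nn) c0 _ _ (OPT_IND_flat R B G sM n lm)).
    by apply: OPT_IND_gt0 => //; case: (inst n nn).
  apply: (Cost_agent_ge f (price := fun t => if (t < n0)%N then p' else p)) => [|pi t].
    exact: sn.
  case: ltnP => tn; first exact: day_cost_early.
  exact/day_cost_late/lm/ltn_ord/sn.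
have x1 k : x k <= 1.
  by rewrite -x0E; elim: k => // k; exact: le_trans (xS k).
(* Buying early is rare: at horizon [n0] the benchmark is at most [n0], so
   [p' * (1 - x n0) <= c * n0]. As [p <= B = M * p'], repricing these purchases at [p] costs at most
   [C]. *)
have buy0 : p * (1 - x n0) <= C.
  have : p' * (1 - x n0) <= c * n0%:R.
    have := bound n0 (leqnn _); rewrite subrr mulr0 addr0 => H.
    have : c * Num.min p n0%:R <= c * n0%:R by rewrite ler_wpM2l// ge_min lexx orbT.
    have : 0 <= \sum_(t < n0) x t.+1 by apply: sumr_ge0 => t _; exact: survival_ge0.
    by move: H; lra.
  rewrite -(ler_pM2l M0) -/C; apply: le_trans.
  have : p <= M%:R * p' by rewrite mulrC divfK ?gt_eqF// ge_min lexx.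
  by move=> pM; rewrite [leRHS]mulrA; apply: ler_wpM2r; rewrite // subr_ge0.
apply: (absurd_survival x) => // [n|n nn]; first exact: survival_ge0.
have := bound n nn.
have : 0 <= p' * (1 - x n0) by rewrite mulr_ge0 ?divr_ge0// subr_ge0.
lra.
Qed.
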